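(* Let $n\ge 1$, let $\beta_1,\beta_2,\beta_3\in\mathbb{R}$ be parameters, and for $1\le r\le n$ let $$I_r=\beta_1\left(z_1z_2\cdots z_{2n}\,\Theta^{1,2n}_{2r-1,0}+\frac{1}{z_1z_2\cdots z_{2n}}\,\Theta^{1,2n}_{2r-1,1}\right)+\beta_2\,\Theta^{1,2n}_{2r,1}+\beta_3\,\Theta^{1,2n}_{2r,0},$$ a function of the nonzero real variables $z_1,\dots,z_{2n}$, where the argument of $\Theta$ is $f_i=z_1^2z_2^2\cdots z_{i-1}^2z_i$. Then for all $1\le r,s\le n$, $$\{I_r,I_s\}_z=0.$$
   Context: For integers $a\le b$, $r\ge 0$, and $\epsilon$ an integer (only its residue mod 2 matters), the multi-sum with argument $f_i$ is $$\Theta^{a,b}_{r,\epsilon}=\sum_{a\le i_1<i_2<\cdots<i_r\le b}\ \prod_{j=1}^r (f_{i_j})^{(-1)^{j+\epsilon}},$$ with $\Theta^{a,b}_{0,\epsilon}=1$ (and $\Theta^{a,b}_{r,\epsilon}=0$ for $r>b-a+1$). Here $f_1=z_1$ and $f_i=z_1^2\cdots z_{i-1}^2z_i$ for $1\le i\le 2n$. The Poisson bracket of differentiable functions $g,h$ of $z_1,\dots,z_{2n}$ is $\{g,h\}_z=\nabla_z(g)\,\Omega\,(\nabla_z(h))^T$, where $\nabla_z$ is the row gradient and $\Omega$ is the antisymmetric $2n\times 2n$ matrix with $\Omega_{ij}=(-1)^{j-i+1}z_iz_j$ for $i<j$. *)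

(* Defs.v *)
From HB Require Import structures.
From mathcomp Require Import all_boot all_order all_algebra.
From mathcomp Require Import all_classical all_reals all_analysis.

Set Implicit Arguments.
Unset Strict Implicit.
Unset Printing Implicit Defensive.

Import Order.TTheory GRing.Theory Num.Theory.
Import numFieldNormedType.Exports.

Local Open Scope ring_scope.

(* Convention: a family x_1, ..., x_m is indexed by 'I_m, and the i-th member
   of the family is the one at the ordinal of value i - 1. *)

(* The multi-sum Theta^{a,b}_{r,eps} with argument f = (f_1, ..., f_m), where
   1 <= a and b <= m.  The index set i_1 < ... < i_r is a strictly increasing
   finite function t, with i_{j+1} = (t j).+1; the sign exponents are taken in
   int, so that only the parity of eps matters. *)
Definition Theta (R : realType) (m : nat) (f : 'I_m -> R) (a b r : nat)
    (eps : int) : R :=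
  \sum_(t : {ffun 'I_r -> 'I_m} |
        [forall j : 'I_r, (a <= (t j).+1 <= b)%N] &&
        [forall j : 'I_r, forall k : 'I_r, ((j < k)%N ==> (t j < t k)%N)])
    \prod_(j < r) f (t j) ^ ((-1) ^ (j.+1%:Z + eps)).

(* f_i = z_1^2 ... z_{i-1}^2 z_i *)
Definition farg (R : realType) (m : nat) (z : 'rV[R]_m) (i : 'I_m) : R :=
  (\prod_(k < m | (k < i)%N) z 0 k ^+ 2) * z 0 i.

Definition gradient (R : realType) (m : nat) (g : 'rV[R]_m -> R)
    (z : 'rV[R]_m) : 'rV[R]_m :=
  \row_i 'D_(delta_mx 0 i) g z.

Definition Omega (R : realType) (m : nat) (z : 'rV[R]_m) : 'M[R]_m :=
  \matrix_(i, j)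
    if (i < j)%N then (-1) ^+ (j - i).+1 * z 0 i * z 0 j
    else if (j < i)%N then - ((-1) ^+ (i - j).+1 * z 0 j * z 0 i)
    else 0.

(* The product is a 1 x 1 matrix; the bracket is its only entry. *)
Definition poisson (R : realType) (m : nat) (g h : 'rV[R]_m -> R)
    (z : 'rV[R]_m) : R :=
  (gradient g z *m Omega z *m (gradient h z)^T) 0 0.

Definition integral_I (R : realType) (n : nat) (beta1 beta2 beta3 : R)
    (r : nat) (z : 'rV[R]_(2 * n)) : R :=
  let Z := \prod_(i < 2 * n) z 0 i in
  let T k eps := Theta (farg z) 1 (2 * n) k eps in
  beta1 * (Z * T (2 * r - 1)%N 0 + Z^-1 * T (2 * r - 1)%N 1)
  + beta2 * T (2 * r)%N 1 + beta3 * T (2 * r)%N 0.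

(* Main.v *)
(** In the variables log z_i the bracket is constant, and it turns out that
    {f_i, f_j} = f_i f_j for i < j and {f_i, Z} = f_i Z for Z = z_1 ... z_2n, so
    Z behaves like one more f.  The multi-sums are the coefficients of the
    entries of the transfer matrix T(x), the product of the matrices
    [[1, f_i]; [x / f_i, 1]], and sum_r x^r I_r is, up to a constant, the trace
    of T(x) times a twist depending on Z and the beta's.  The brackets of
    the entries of T(x) and T(y) satisfy quadratic relations with coefficients
    proportional to 1 / (x - y), which follow by induction on the number of
    factors; they imply that the twisted traces at x and y commute, and
    comparing coefficients of x^r y^s gives {I_r, I_s} = 0. *)

Require Import Defs.
From HB Require Import structures.
From mathcomp Require Import all_boot all_order all_algebra.
From mathcomp Require Import all_classical all_reals all_analysis.
From mathcomp Require Import ring.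
Import Order.TTheory GRing.Theory Num.Theory.
Import numFieldNormedType.Exports.
Local Open Scope ring_scope.

(** * Quadratic brackets of the transfer-matrix entries, for an abstract alternating form *)

Section TransferMatrix.

Context {R : fieldType} {V : lmodType R}.
Variable w : V -> V -> R.
Hypothesis wDl : forall u v t, w (u + v) t = w u t + w v t.
Hypothesis wZl : forall l u t, w (l *: u) t = l * w u t.
Hypothesis wC : forall u v, w u v = - w v u.
Hypothesis wvv : forall u, w u u = 0.

(** Indices below [m] are the matrix factors; index [m] is the extra argument that enters only
    through the twist. *)
Variables (m : nat) (f : nat -> R) (F : nat -> V).
Hypothesis f_neq0 : forall k, (k <= m)%N -> f k != 0.
Hypothesis wF : forall i j, (i < j <= m)%N -> w (F i) (F j) = 1.

(* Capital letters are differentials at a fixed point: [F] of the logarithm of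
   [f], and [A], [B], [C], [D] of [a], [b], [c], [d]. *)
Variables (a b c d : R -> nat -> R) (A B C D : R -> nat -> V).
Hypotheses (a0 : forall x, a x 0 = 1) (b0 : forall x, b x 0 = 0)
  (c0 : forall x, c x 0 = 0) (d0 : forall x, d x 0 = 1).
Hypotheses (A0 : forall x, A x 0 = 0) (B0 : forall x, B x 0 = 0)
  (C0 : forall x, C x 0 = 0) (D0 : forall x, D x 0 = 0).
Hypothesis aS : forall x k, (k < m)%N ->
  a x k.+1 = a x k + x * (f k)^-1 * b x k.
Hypothesis bS : forall x k, (k < m)%N -> b x k.+1 = b x k + f k * a x k.
Hypothesis cS : forall x k, (k < m)%N -> c x k.+1 = c x k + (f k)^-1 * d x k.
Hypothesis dS : forall x k, (k < m)%N -> d x k.+1 = d x k + x * f k * c x k.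
Hypothesis AS : forall x k, (k < m)%N ->
  A x k.+1 = A x k + (x * (f k)^-1) *: (B x k + - b x k *: F k).
Hypothesis BS : forall x k, (k < m)%N ->
  B x k.+1 = B x k + f k *: (A x k + a x k *: F k).
Hypothesis CS : forall x k, (k < m)%N ->
  C x k.+1 = C x k + (f k)^-1 *: (D x k + - d x k *: F k).
Hypothesis DS : forall x k, (k < m)%N ->
  D x k.+1 = D x k + (x * f k) *: (C x k + c x k *: F k).

Let wDr u v t : w u (v + t) = w u v + w u t.
Proof. by rewrite wC wDl opprD -!(wC u). Qed.

Let wZr l u v : w u (l *: v) = l * w u v.
Proof. by rewrite wC wZl -mulrN -wC. Qed.

Let w0l u : w 0 u = 0.
Proof. by rewrite -(scale0r 0) wZl mul0r. Qed.

(** Every [F i] with [i < j] pairs to 1 with [F j], so pairing with [F j] acts as an Euler operator: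
    it multiplies each entry by its degree in the earlier [f i], namely 0, 1, -1, 0. *)
Let wFl k j x : (k <= j <= m)%N ->
  [/\ w (A x k) (F j) = 0, w (B x k) (F j) = b x k,
      w (C x k) (F j) = - c x k & w (D x k) (F j) = 0].
Proof.
elim: k => [|k IH] /andP[kj jm].
  by rewrite A0 B0 C0 D0 !w0l b0 c0 oppr0.
have [|wA wB wC' wD] := IH; first by rewrite jm ltnW.
have km : (k < m)%N by apply: leq_trans jm.
have wk : w (F k) (F j) = 1 by apply: wF; rewrite kj.
rewrite AS // BS // CS // DS // bS // cS // !(wDl, wZl) wA wB wC' wD wk.
split; ring.
Qed.

Let wFr k j x : (k <= j <= m)%N ->
  [/\ w (F j) (A x k) = 0, w (F j) (B x k) = - b x k,
      w (F j) (C x k) = c x k & w (F j) (D x k) = 0].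
Proof.
move=> kjm; have [wA wB wC' wD] := wFl _ _ x kjm.
by split; rewrite wC ?wA ?wB ?wC' ?wD ?oppr0 ?opprK.
Qed.

(* The product of the [[1, f i]; [x / f i, 1]], i < k, is [[a, b]; [x c, d]].
   On both sides a and d have weight 0 in the f's, b has weight 1 and c has
   weight -1; these r-matrix relations do not depend on [k]. *)
Let brackets k := forall x y, x != y ->
  [/\ [/\ w (A x k) (A y k) = 0, w (B x k) (B y k) = 0,
          w (C x k) (C y k) = 0 & w (D x k) (D y k) = 0],
      [/\ w (A x k) (B y k) = x / (x - y) * (a x k * b y k - b x k * a y k),
          w (A x k) (C y k) = x / (x - y) * (c x k * a y k - a x k * c y k)
        & w (A x k) (D y k)
            = x * y / (x - y) * (c x k * b y k - b x k * c y k)],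
      w (B x k) (C y k) = (x - y)^-1 * (d x k * a y k - a x k * d y k),
      w (B x k) (D y k) = y / (x - y) * (d x k * b y k - b x k * d y k)
    & w (C x k) (D y k) = y / (x - y) * (c x k * d y k - d x k * c y k)].

(** Adding a factor produces pairs of entries in both orders, whereas [brackets] lists only one;
    antisymmetry and the exchange of [x] and [y] give the other. *)
Let brackets_sym k x y : brackets k -> x != y ->
  [/\ [/\ w (B x k) (A y k) = y / (x - y) * (b x k * a y k - a x k * b y k),
          w (C x k) (A y k) = y / (x - y) * (a x k * c y k - c x k * a y k)
        & w (D x k) (A y k)
            = x * y / (x - y) * (b x k * c y k - c x k * b y k)],
      w (C x k) (B y k) = (x - y)^-1 * (a x k * d y k - d x k * a y k),
      w (D x k) (B y k) = x / (x - y) * (b x k * d y k - d x k * b y k)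
    & w (D x k) (C y k) = x / (x - y) * (d x k * c y k - c x k * d y k)].
Proof.
move=> IH xy; have yx : y != x by rewrite eq_sym.
have [_ [e1 e2 e3] e4 e5 e6] := IH _ _ yx.
have h1 : x - y != 0 by rewrite subr_eq0.
have h2 : y - x != 0 by rewrite subr_eq0.
by split; [split| | |]; rewrite wC ?e1 ?e2 ?e3 ?e4 ?e5 ?e6; field; rewrite h1.
Qed.

(** By bilinearity, the recursion reduces brackets at [k.+1] to brackets at [k], degrees against
    [F k], and [w (F k) (F k) = 0]; what remains is a rational identity. *)
Let bracketsP k : (k <= m)%N -> brackets k.
Proof.
elim: k => [_ x y xy|k IH km x y xy].
  rewrite !A0 !B0 !C0 !D0 !w0l a0 b0 c0 d0 a0 b0 c0 d0.
  by split; [split|split| | |]; ring.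
have {}IH : brackets k by apply: IH; apply: ltnW.
have [[e1 e2 e3 e4] [e5 e6 e7] e8 e9 e10] := IH _ _ xy.
have [[s1 s2 s3] s4 s5 s6] := brackets_sym _ _ _ IH xy.
have kkm : (k <= k <= m)%N by rewrite leqnn ltnW.
have [l1 l2 l3 l4] := wFl _ _ x kkm.
have [r1 r2 r3 r4] := wFr _ _ y kkm.
have fk : f k != 0 by rewrite f_neq0 // ltnW.
have h1 : x - y != 0 by rewrite subr_eq0.
have E := (l1, l2, l3, l4, r1, r2, r3, r4, s1, s2, s3, s4, s5, s6,
  (e1, e2, e3, e4, e5, e6, e7, e8, e9, e10), wvv).
split; [split|split| | |]; rewrite !(AS, BS, CS, DS, aS, bS, cS, dS) //.
all: rewrite !(wDl, wDr, wZl, wZr) !E.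
all: field; rewrite ?fk ?h1 //.
Qed.

Variables (p q s : R).

(* The differential of the trace of the transfer matrix at [m] times
   [[q, p (f m)]; [p x / f m, s]]: the twist behaves as one more site. *)
Let dtr x := (p * x) *: (f m *: (C x m + c x m *: F m)
    + (f m)^-1 *: (B x m + - b x m *: F m)) + q *: A x m + s *: D x m.

Lemma bracket_twisted_trace x y : w (dtr x) (dtr y) = 0.
Proof.
(* The relations have a pole at [x = y], where [wvv] applies instead. *)
have [->//|xy] := eqVneq x y.
have [[e1 e2 e3 e4] [e5 e6 e7] e8 e9 e10] := bracketsP _ (leqnn m) _ _ xy.
have [[s1 s2 s3] s4 s5 s6] := brackets_sym _ _ _ (bracketsP _ (leqnn m)) xy.
have kkm : (m <= m <= m)%N by rewrite leqnn.
have [l1 l2 l3 l4] := wFl _ _ x kkm.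
have [r1 r2 r3 r4] := wFr _ _ y kkm.
have fk : f m != 0 by rewrite f_neq0.
have h1 : x - y != 0 by rewrite subr_eq0.
have E := (l1, l2, l3, l4, r1, r2, r3, r4, s1, s2, s3, s4, s5, s6,
  (e1, e2, e3, e4, e5, e6, e7, e8, e9, e10), wvv).
rewrite /dtr !(wDl, wDr, wZl, wZr) !E.
field; rewrite ?fk ?h1 //.
Qed.

End TransferMatrix.

(** * Recursion of the multi-sums on their upper bound *)

Section Theta_recursion.

Context {R : realType} {m : nat}.
Variable f : 'I_m -> R.

Lemma Theta0 b e : Theta f 1 b 0 e = 1.
Proof.
rewrite /Theta (eq_bigl xpredT) => [|t]; last first.
  by apply/andP; split; apply/forallP => -[].
rewrite (eq_bigr (fun=> 1)) => [|t _]; last by rewrite big_ord0.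
by rewrite sumr_const card_ffun !card_ord.
Qed.

(** Either the largest index stays within the old bound, or it is the new one; in the latter case
    removing it leaves an arbitrary increasing sequence of length [r] within the old bound. *)
Lemma ThetaS k (km : (k < m)%N) r e :
  Theta f 1 k.+1 r.+1 e = Theta f 1 k r.+1 e
  + Theta f 1 k r e * f (Ordinal km) ^ ((-1) ^ (r.+1%:Z + e)).
Proof.
pose last (t : {ffun 'I_r.+1 -> 'I_m}) := t ord_max.
pose ext (t : {ffun 'I_r -> 'I_m}) : {ffun 'I_r.+1 -> 'I_m} :=
  [ffun j => oapp t (Ordinal km) (unlift ord_max j)].
pose res (t : {ffun 'I_r.+1 -> 'I_m}) : {ffun 'I_r -> 'I_m} :=
  [ffun j => t (lift ord_max j)].
have extK t : res (ext t) = t.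
  by apply/ffunP => j; rewrite !ffunE liftK.
rewrite {1}/Theta (bigID (fun t => (last t < k)%N)) /=; congr (_ + _).
  (* By monotonicity, bounding the last entry bounds all of them. *)
  apply: eq_bigl => t; apply/andP/andP.
    move=> [/andP[/forallP tk /forallP ti] lt]; split; last exact/forallP.
    apply/forallP => j; have := ti j => /forallP/(_ ord_max)/implyP tj.
    have [jr|jr] := ltnP j r.
      by apply: leq_trans lt; apply: leq_trans (tj jr) _.
    suff -> : j = ord_max by [].
    by apply/val_inj/eqP; rewrite eqn_leq jr andbT -ltnS ltn_ord.
  move=> [/forallP tk ti]; rewrite ti andbT; split; last exact: tk.
  by apply/forallP => j; have /= tj := tk j; exact: ltnW.
(* The remaining sequences end in [k], and [ext] appends exactly this entry. *)
rewrite (reindex_onto ext res) => [|t]; last first.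
  move=> /andP[/andP[/forallP tk _] lt].
  apply/ffunP => j; rewrite !ffunE; case: unliftP => [i ->|->] /=.
    by rewrite ffunE.
  by apply/val_inj/eqP; rewrite /= eqn_leq leqNgt lt -ltnS tk.
rewrite {1}/Theta big_distrl /=; apply: eq_big => [t|t _]; last first.
  rewrite big_ord_recr /= ffunE unlift_none /=; congr (_ * _).
  apply: eq_bigr => j _; rewrite ffunE.
  have -> : widen_ord (leqnSn r) j = lift ord_max j.
    by apply/val_inj; rewrite /= /bump leqNgt ltn_ord.
  by rewrite liftK.
rewrite extK eqxx andbT /last ffunE unlift_none /= ltnn andbT.
have extl j : ext t (lift ord_max j) = t j by rewrite ffunE liftK.
have extm : ext t ord_max = Ordinal km by rewrite ffunE unlift_none.
have lj (j : 'I_r) : lift ord_max j = j :> nat.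
  by rewrite /= /bump leqNgt ltn_ord.
apply/andP/andP => -[/forallP tk /forallP ti]; split.
- apply/forallP => j; have /forallP/(_ ord_max) := ti (lift ord_max j).
  by rewrite extl extm lj ltn_ord.
- apply/forallP => j; apply/forallP => i.
  have /forallP/(_ (lift ord_max i)) := ti (lift ord_max j).
  by rewrite !extl !lj.
- apply/forallP => j; case: (unliftP ord_max j) => [i ->|->].
    by have /= tj := tk i; rewrite extl /=; exact: ltnW.
  by rewrite extm /= ltnSn.
- apply/forallP => j; apply/forallP => i; apply/implyP.
  case: (unliftP ord_max j) => [j' ->|->]; last first.
    by rewrite /= ltnNge -ltnS ltn_ord.
  case: (unliftP ord_max i) => [i' ->|-> _].
    by rewrite !extl !lj; have /forallP/(_ i')/implyP := ti j'.
  by rewrite extl extm; have := tk j'.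
Qed.

Lemma Theta_gt k r e : (k <= m)%N -> (k < r)%N -> Theta f 1 k r e = 0.
Proof.
elim: k r => [|k IH] [//|r] km kr.
  by rewrite /Theta big1 // => t /andP[/forallP/(_ ord0)].
by rewrite ThetaS !IH ?mul0r ?addr0 // 1?ltnW // ltnW.
Qed.

End Theta_recursion.

(** * Gradients and logarithmic gradients at a fixed point *)

Section Gradient.

Context {R : realType} {m : nat}.
Variable z : 'rV[R]_m.
Implicit Types (g h : 'rV[R]_m -> R) (G H : 'rV[R]_m).

(** Partial derivatives are all that the Poisson bracket sees. Existence is carried along with the
    value, so that the sum, product and inverse rules apply. *)
Definition has_gradient g G :=
  forall i, is_derive z (delta_mx 0 i : 'rV[R]_m) g (G 0 i).

Lemma has_gradientE g G : has_gradient g G -> gradient g z = G.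
Proof. by move=> gG; apply/rowP => i; rewrite mxE; have [_ ->] := gG i. Qed.

Lemma has_gradient_eq g G H : has_gradient g G -> G = H -> has_gradient g H.
Proof. by move=> + <-. Qed.

Lemma has_gradient_cst c : has_gradient (fun=> c) 0.
Proof. by move=> i; rewrite mxE; exact: is_derive_cst. Qed.

Lemma has_gradientD g h G H : has_gradient g G -> has_gradient h H ->
  has_gradient (fun y => g y + h y) (G + H).
Proof.
by move=> gG hH i; rewrite mxE; exact: (is_deriveD (gG i) (hH i)).
Qed.

Lemma has_gradientM g h G H : has_gradient g G -> has_gradient h H ->
  has_gradient (fun y => g y * h y) (g z *: H + h z *: G).
Proof.
by move=> gG hH i; rewrite !mxE; exact: (is_deriveM (gG i) (hH i)).
Qed.

Lemma has_gradientZ c g G : has_gradient g G ->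
  has_gradient (fun y => c * g y) (c *: G).
Proof.
move=> gG.
apply: has_gradient_eq (has_gradientM _ _ _ _ (has_gradient_cst c) gG) _.
by rewrite scaler0 addr0.
Qed.

Lemma has_gradientV g G : g z != 0 -> has_gradient g G ->
  has_gradient (fun y => (g y)^-1) (- (g z) ^- 2 *: G).
Proof.
move=> gz gG i; rewrite mxE; have [dg <-] := gG i.
by split; [exact: derivableV|rewrite deriveV].
Qed.

Lemma has_gradient_sum (I : Type) (r : seq I) (g : I -> 'rV[R]_m -> R)
    (dg : I -> 'rV[R]_m) :
  (forall i, has_gradient (g i) (dg i)) ->
  has_gradient (fun y => \sum_(i <- r) g i y) (\sum_(i <- r) dg i).
Proof.
move=> gdg; elim: r => [|i r IH].
  under eq_fun do rewrite big_nil.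
  by rewrite big_nil; exact: has_gradient_cst.
under eq_fun do rewrite big_cons.
by rewrite big_cons; exact: has_gradientD.
Qed.

Lemma has_gradient_coord k : has_gradient (fun y => y 0 k) (delta_mx 0 k).
Proof.
(* The coordinate is packed as a linear map, which is its own differential. *)
move=> i; have @f : {linear 'rV[R]_m -> R}.
  by exists (fun N : 'rV[R]_m => N 0 k); do 2![eexists]; do ?[constructor];
     rewrite ?mxE// => ? *; rewrite ?mxE//; move=> ?; rewrite !mxE.
have fd : differentiable f z by exact: differentiable_coord.
split; first exact: diff_derivable.
rewrite (@deriveE _ _ _ f) // (@diff_lin _ _ _ f) /f /= ?mxE 1?eq_sym //.
exact: coord_continuous.
Qed.

Hypothesis z_neq0 : forall i, z 0 i != 0.

(** For a monomial [g], [e l] is the exponent of the [l]-th coordinate. *)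
Definition has_log_gradient g (e : 'I_m -> R) :=
  has_gradient g (g z *: \row_l (e l / z 0 l)).

Lemma has_log_gradient_coord k :
  has_log_gradient (fun y => y 0 k) (fun l => (l == k)%:R).
Proof.
apply: has_gradient_eq (has_gradient_coord k) _.
apply/rowP => l; rewrite !mxE /=.
by case: eqVneq => [->|]; rewrite ?mul1r ?mulfV // mul0r mulr0.
Qed.

Lemma has_log_gradientM g h e e' :
  has_log_gradient g e -> has_log_gradient h e' ->
  has_log_gradient (fun y => g y * h y) (fun l => e l + e' l).
Proof.
move=> ge he; apply: has_gradient_eq (has_gradientM _ _ _ _ ge he) _.
by apply/rowP => l; rewrite !mxE; ring.
Qed.

Lemma has_log_gradient_prod (I : Type) (r : seq I) (P : pred I)
    (g : I -> 'rV[R]_m -> R) e :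
  (forall i, has_log_gradient (g i) (e i)) ->
  has_log_gradient (fun y => \prod_(i <- r | P i) g i y)
    (fun l => \sum_(i <- r | P i) e i l).
Proof.
move=> ge; elim: r => [|i r IH].
  rewrite /has_log_gradient big_nil scale1r; under eq_fun do rewrite big_nil.
  apply: has_gradient_eq (has_gradient_cst 1) _.
  by apply/rowP => l; rewrite !mxE big_nil mul0r.
have [Pi|nPi] := boolP (P i); last first.
  rewrite (_ : (fun y => _) = fun y => \prod_(j <- r | P j) g j y); last first.
    by apply/funext => y; rewrite big_cons (negbTE nPi).
  rewrite (_ : (fun l => _) = fun l => \sum_(j <- r | P j) e j l) //.
  by apply/funext => l; rewrite big_cons (negbTE nPi).
rewrite (_ : (fun y => _) = fun y => g i y * \prod_(j <- r | P j) g j y);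
  last by apply/funext => y; rewrite big_cons Pi.
rewrite (_ : (fun l => _) = fun l => e i l + \sum_(j <- r | P j) e j l);
  last by apply/funext => l; rewrite big_cons Pi.
exact: has_log_gradientM.
Qed.

Lemma has_log_gradient_prod_coord :
  has_log_gradient (fun y => \prod_k y 0 k) (fun l => 1).
Proof.
have := has_log_gradient_prod _ (index_enum 'I_m) xpredT _ _
  has_log_gradient_coord.
congr has_log_gradient; apply/funext => l.
by rewrite (bigD1 l) //= eqxx big1 ?addr0 // => i /negbTE; rewrite eq_sym => ->.
Qed.

(** The exponents are 2 before position [i] and 1 at [i]; two indicators express this so that later
    sums split into two initial segments. *)
Lemma has_log_gradient_farg i : has_log_gradient (fun y => farg y i)
  (fun l => (l < i)%:R + (l < i.+1)%:R).
Proof.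
have sq k := has_log_gradientM _ _ _ _ (has_log_gradient_coord k)
  (has_log_gradient_coord k).
have := has_log_gradientM _ _ _ _ (has_log_gradient_prod _ (index_enum 'I_m)
  (fun k => (k < i)%N) _ _ sq) (has_log_gradient_coord i).
congr has_log_gradient; apply/funext => l.
rewrite big_mkcond (bigD1 l) //= eqxx big1 ?addr0; last first.
  by move=> k kl; case: ifP => // _; rewrite eq_sym (negbTE kl) addr0.
have -> : (l < i.+1)%N = (l == i) || (l < i)%N by rewrite ltnS leq_eqVlt.
by case: eqVneq => [->|_]; rewrite ?ltnn //=; case: ltnP; rewrite ?addr0 ?add0r.
Qed.

End Gradient.

(** * The bracket as a bilinear form, constant in logarithmic coordinates *)

Section Bracket.

Context {R : realType} {m : nat}.
Variable z : 'rV[R]_m.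

Definition bracket (u v : 'rV[R]_m) : R := (u *m Omega z *m v^T) 0 0.

Lemma bracketDl u v t : bracket (u + v) t = bracket u t + bracket v t.
Proof. by rewrite /bracket !mulmxDl mxE. Qed.

Lemma bracketZl l u t : bracket (l *: u) t = l * bracket u t.
Proof. by rewrite /bracket -!scalemxAl mxE. Qed.

Lemma bracketC u v : bracket u v = - bracket v u.
Proof.
rewrite /bracket -[in LHS](trmxK (u *m _ *m _)) mxE !trmx_mul trmxK mulmxA.
suff -> : (Omega z)^T = - Omega z by rewrite mulmxN mulNmx mxE.
by apply/matrixP => i j; rewrite !mxE; case: ltngtP; rewrite ?opprK ?oppr0.
Qed.

Lemma bracketvv u : bracket u u = 0.
Proof.
by apply/eqP; rewrite -[_ == 0](@mulrn_eq0 _ _ 2) mulr2n {1}bracketC addNr.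
Qed.

(** [Omega] without its factors [z], extended to all natural indices so that partial sums admit
    induction. *)
Definition omega_sign (k l : nat) : R :=
  if (k < l)%N then (-1) ^+ (l - k).+1
  else if (l < k)%N then - (-1) ^+ (k - l).+1 else 0.

(** The left side pairs the exponents of an argument with the coordinate [l]. Raising [i] adds two
    consecutive signs, which cancel unless [l] is [i] or [i.+1]. *)
Lemma sum_omega_sign i l :
  \sum_(k < i) omega_sign k l + \sum_(k < i.+1) omega_sign k l
  = (-1) ^+ l.+1 + (l == i)%:R.
Proof.
elim: i => [|i IH].
  rewrite big_ord_recr !big_ord0 /= !add0r /omega_sign ltn0 subn0.
  by case: l => [|l]; rewrite /= ?expr1 ?addNr ?addr0.
rewrite [X in _ + X]big_ord_recr [in LHS]addrC addrAC.
move: IH; rewrite [X in _ + X = _ -> _]big_ord_recr /= => IH.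
have E : omega_sign i l + omega_sign i.+1 l = (l == i.+1)%:R - (l == i)%:R.
  rewrite /omega_sign; have [li|li] := ltnP l i.
    rewrite ltnNge ltnW // ltnNge (leq_trans (ltnW li)) //= ltnS ltnW //.
    rewrite !ltn_eqF ?ltnS ?(ltnW li) // subSn ?(ltnW li) //.
    by rewrite [in X in _ - X]exprS mulN1r opprK subrr addNr.
  move: li; rewrite leq_eqVlt => /predU1P[->|].
    rewrite ltnn leqnn ltnNge leqnSn /= eqxx ltn_eqF // subSnn.
    by rewrite sqrrN expr1n.
  move=> il; have /predU1P[<-|li] : (i.+1 == l) || (i.+1 < l)%N.
      by rewrite -leq_eqVlt.
    by rewrite leqnn ltnn eqxx gtn_eqF // subSnn sqrrN expr1n addr0 subr0.
  rewrite li il !gtn_eqF ?(ltnW li) // -(subnSK (ltnW li)).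
  by rewrite [in X in X + _]exprS mulN1r addNr subr0.
transitivity ((-1) ^+ l.+1 + (l == i)%:R
  + (omega_sign i l + omega_sign i.+1 l)).
  by rewrite -IH big_ord_recr /=; ring.
by rewrite E; ring.
Qed.

Lemma sum_sign j : \sum_(l < j) (-1) ^+ l.+1 = - (odd j)%:R :> R.
Proof.
elim: j => [|j IH]; first by rewrite big_ord0 oppr0.
rewrite big_ord_recr /= IH exprS -signr_odd.
by case: (odd j); rewrite /= ?expr1 ?expr0; ring.
Qed.

Lemma sum_delta i j : (i < j)%N -> \sum_(l < j) (l == i :> nat)%:R = 1 :> R.
Proof.
move=> ij; rewrite (bigD1 (Ordinal ij)) //= eqxx big1 ?addr0 // => l.
by move=> /negbTE li; rewrite -[_ == i]/(l == Ordinal ij) li.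
Qed.

Lemma sum_ltn (h : nat -> R) i : (i <= m)%N ->
  \sum_(k < m) (k < i)%:R * h k = \sum_(k < i) h k.
Proof.
move=> im; rewrite (big_ord_widen _ _ im) [RHS]big_mkcond.
by apply: eq_bigr => k _; case: ifP; rewrite ?mul1r ?mul0r.
Qed.

Hypothesis z_neq0 : forall i, z 0 i != 0.

(** The factors [z] of [Omega] cancel the denominators. *)
Lemma bracket_row (e e' : nat -> R) :
  bracket (\row_l (e l / z 0 l)) (\row_l (e' l / z 0 l))
  = \sum_(l < m) e' l * \sum_(k < m) e k * omega_sign k l.
Proof.
rewrite /bracket mxE; apply: eq_bigr => l _; rewrite !mxE mulr_suml mulr_sumr.
apply: eq_bigr => k _; rewrite !mxE /omega_sign.
have zl := z_neq0 l; have zk := z_neq0 k.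
by case: ltngtP => _; [field|field|ring]; rewrite zl.
Qed.

End Bracket.

(** After a factor [x] is cancelled, a polynomial of size at most [N] vanishes at the [N] distinct
    nonzero points 1, ..., [N]. *)
Lemma power_sum_eq0 (R : numFieldType) N (c : nat -> R) :
  (forall x, \sum_(r < N) x ^+ r.+1 * c r = 0) ->
  forall r, (r < N)%N -> c r = 0.
Proof.
move=> c0 r rN; pose p := \poly_(i < N) c i.
suff /(congr1 (fun p : {poly R} => p`_r)) : p = 0 by rewrite coef_poly rN coef0.
apply: (@roots_geq_poly_eq0 _ _ [seq i.+1%:R | i <- iota 0 N]).
- apply/allP => _ /mapP[i _ ->]; apply/rootP.
  apply: (@mulfI _ (i.+1%:R : R)); first by rewrite pnatr_eq0.
  rewrite mulr0 horner_poly mulr_sumr -[RHS](c0 i.+1%:R).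
  by apply: eq_bigr => j _; rewrite mulrCA -exprS mulrC.
- rewrite map_inj_uniq ?iota_uniq // => i j /eqP.
  by rewrite eqr_nat => /eqP[].
- by rewrite size_map size_iota size_poly.
Qed.

Lemma sign_expz_or (e : int) : (-1 : int) ^ e = 1 \/ (-1 : int) ^ e = -1.
Proof.
by case: e => k; rewrite /exprz -signr_odd; case: odd; [right|left|right|left].
Qed.

(** * Generating series of the multi-sums and of the integrals *)

Section Generating.

Context {R : realType} {n : nat}.
Implicit Types (x : R) (z : 'rV[R]_(2 * n)).

(** The pairs [(odd, eps)] equal to (0,1), (1,1), (1,0), (0,0) give the entries [a], [b], [c], [d]
    of the transfer matrix. *)
Definition theta_series (odd : nat) (eps : int) x k z : R :=
  \sum_(r < n.+1) x ^+ r * Theta (farg z) 1 k (2 * r + odd) eps.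

(** The default value of [oapp] supplies the product of all coordinates as the extra argument at
    [k = 2 * n]. *)
Definition arg k z : R := oapp (farg z) (\prod_i z 0 i) (insub k).

Lemma arg_ord z k (km : (k < 2 * n)%N) : arg k z = farg z (Ordinal km).
Proof. by rewrite /arg insubT. Qed.

Lemma arg_max z : arg (2 * n) z = \prod_i z 0 i.
Proof. by rewrite /arg insubF // ltnn. Qed.

Lemma theta_series0 odd eps x z : theta_series odd eps x 0 z = (odd == 0)%:R.
Proof.
rewrite /theta_series big_ord_recl expr0 mul1r big1 ?addr0; last first.
  by move=> r _; rewrite Theta_gt ?mulr0.
by case: odd => [|odd]; [exact: Theta0|exact: Theta_gt].
Qed.

Lemma sign_expz r (eps : int) :
  (-1 : int) ^ (r%:Z + eps) = (-1) ^+ r * (-1) ^ eps.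
Proof. by rewrite exprzDr. Qed.

Lemma theta_series_even eps x k z : theta_series 0 eps x k z
  = 1 + \sum_(r < n) x ^+ r.+1 * Theta (farg z) 1 k (2 * r.+1) eps.
Proof.
rewrite /theta_series big_ord_recl expr0 mul1r Theta0; congr (_ + _).
by apply: eq_bigr => r _; rewrite addn0.
Qed.

Lemma theta_series_odd eps x k z : (k <= 2 * n)%N ->
  x * theta_series 1 eps x k z
  = \sum_(r < n) x ^+ r.+1 * Theta (farg z) 1 k (2 * r).+1 eps.
Proof.
(* The top term has length [2 * n + 1], more than the available indices. *)
move=> km; rewrite /theta_series big_ord_recr /= addn1 Theta_gt //.
rewrite mulr0 addr0 mulr_sumr; apply: eq_bigr => r _.
by rewrite exprS mulrA addn1.
Qed.

(** The factor split off by [ThetaS] sits at an even position, so its exponent is [(-1) ^ eps]; in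
    the odd series the sign is opposite. *)
Lemma theta_seriesS_even eps x k z : (k < 2 * n)%N ->
  theta_series 0 eps x k.+1 z = theta_series 0 eps x k z
  + x * (arg k z ^ ((-1) ^ eps) * theta_series 1 eps x k z).
Proof.
move=> km; rewrite mulrCA theta_series_odd ?(ltnW km) // !theta_series_even.
rewrite -addrA; congr (_ + _); rewrite mulr_sumr -big_split.
apply: eq_bigr => r _ /=; rewrite arg_ord mulnS !addSn add0n.
rewrite ThetaS sign_expz (_ : (-1) ^+ _ = 1) ?mul1r; last first.
  by rewrite -signr_odd /= mul2n odd_double.
by ring.
Qed.

Lemma theta_seriesS_odd eps x k z : (k < 2 * n)%N ->
  theta_series 1 eps x k.+1 z = theta_series 1 eps x k z
  + arg k z ^ (- (-1) ^ eps) * theta_series 0 eps x k z.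
Proof.
move=> km; rewrite /theta_series arg_ord mulr_sumr -big_split.
apply: eq_bigr => r _ /=; rewrite addn0 addn1.
rewrite ThetaS sign_expz (_ : (-1) ^+ _ = -1) ?mulN1r; last first.
  by rewrite -signr_odd /= mul2n odd_double.
by ring.
Qed.

(** The trace of the full transfer matrix times the twist. *)
Definition integral_series (p q s : R) x z : R :=
  p * x * (arg (2 * n) z * theta_series 1 0 x (2 * n) z
           + (arg (2 * n) z)^-1 * theta_series 1 1 x (2 * n) z)
  + q * theta_series 0 1 x (2 * n) z + s * theta_series 0 0 x (2 * n) z.

(** The constant [q + s] comes from the empty multi-sums; the factor [x] on the odd series aligns
    length [2 * r + 1] with length [2 * r.+1]. *)
Lemma integral_seriesE p q s x z :
  integral_series p q s x z
  = q + s + \sum_(r < n) x ^+ r.+1 * @integral_I R n p q s r.+1 z.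
Proof.
transitivity (p * (arg (2 * n) z * (x * theta_series 1 0 x (2 * n) z)
           + (arg (2 * n) z)^-1 * (x * theta_series 1 1 x (2 * n) z))
  + q * theta_series 0 1 x (2 * n) z + s * theta_series 0 0 x (2 * n) z).
  by rewrite /integral_series; ring.
rewrite !theta_series_even !theta_series_odd // arg_max.
transitivity (q + s + (p * ((\prod_i z 0 i) * (\sum_(r < n)
    x ^+ r.+1 * Theta (farg z) 1 (2 * n) (2 * r).+1 0)
  + (\prod_i z 0 i)^-1 * (\sum_(r < n)
    x ^+ r.+1 * Theta (farg z) 1 (2 * n) (2 * r).+1 1))
  + q * (\sum_(r < n) x ^+ r.+1 * Theta (farg z) 1 (2 * n) (2 * r.+1) 1)
  + s * (\sum_(r < n) x ^+ r.+1 * Theta (farg z) 1 (2 * n) (2 * r.+1) 0))).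
  by ring.
congr (_ + _); rewrite !mulr_sumr -big_split mulr_sumr -!big_split.
apply: eq_bigr => r _; rewrite /integral_I mulnS !addSn add0n subn1 /=.
by ring.
Qed.

Variable z0 : 'rV[R]_(2 * n).
Hypothesis z0_neq0 : forall i, z0 0 i != 0.

Definition arg_log_gradient k : 'rV[R]_(2 * n) :=
  if k == (2 * n)%N then \row_l (1 / z0 0 l)
  else \row_l (((l < k)%N%:R + (l < k.+1)%N%:R) / z0 0 l).

Lemma farg_neq0 i : farg z0 i != 0.
Proof.
by rewrite mulf_neq0 //; apply/prodf_neq0 => k _; rewrite expf_neq0.
Qed.

Lemma arg_neq0 k : arg k z0 != 0.
Proof.
rewrite /arg; case: insub => [i|]; [exact: farg_neq0|].
by apply/prodf_neq0.
Qed.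

Lemma has_gradient_arg k : (k <= 2 * n)%N ->
  has_gradient z0 (arg k) (arg k z0 *: arg_log_gradient k).
Proof.
rewrite leq_eqVlt => /predU1P[->|km]; rewrite /arg_log_gradient.
  rewrite eqxx (funext arg_max : arg (2 * n) = fun z => \prod_i z 0 i).
  exact: has_log_gradient_prod_coord.
rewrite ltn_eqF //.
rewrite (funext (fun z => arg_ord z k km) :
  arg k = fun z => farg z (Ordinal km)).
exact: (has_log_gradient_farg _ z0_neq0 (Ordinal km)).
Qed.

Lemma bracket_arg i j : (i < j <= 2 * n)%N ->
  bracket z0 (arg_log_gradient i) (arg_log_gradient j) = 1.
Proof.
move=> /andP[ij jm]; have im := leq_trans ij jm.
pose e k : R := (k < i)%N%:R + (k < i.+1)%N%:R.
have sum_e l : \sum_(k < 2 * n) e k * omega_sign k l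
    = (-1) ^+ l.+1 + (l == i)%:R.
  rewrite -sum_omega_sign.
  rewrite -!(@sum_ltn R (2 * n) (omega_sign ^~ l)) ?(ltnW im) //.
  by rewrite -big_split; apply: eq_bigr => k _; rewrite /= -mulrDl.
have sum_h k : (i < k)%N ->
    \sum_(l < k) ((-1) ^+ l.+1 + (l == i :> nat)%:R) = 1 - (odd k)%:R :> R.
  by move=> ik; rewrite big_split /= sum_sign sum_delta // addrC.
rewrite /arg_log_gradient (ltn_eqF im); case: eqVneq => [jE|jn].
  rewrite (bracket_row z0 z0_neq0 e (fun=> 1)).
  under eq_bigr do rewrite sum_e mul1r.
  (* For the product of all coordinates, the value 1 relies on their number being even. *)
  by rewrite sum_h // mul2n odd_double subr0.
have {}jm : (j < 2 * n)%N by rewrite ltn_neqAle jn.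
rewrite (bracket_row z0 z0_neq0 e
  (fun l => (l < j)%N%:R + (l < j.+1)%N%:R)).
under eq_bigr do rewrite sum_e mulrDl.
rewrite big_split /=.
rewrite !(@sum_ltn R (2 * n) (fun l => (-1) ^+ l.+1 + (l == i)%:R)) //;
  last exact: ltnW.
(* Exactly one of [j] and [j.+1] is odd, so the two sums add up to 1. *)
rewrite (sum_h j ij) (sum_h j.+1 (ltnW ij)) oddS.
by case: (odd j); rewrite subrr subr0 ?add0r ?addr0.
Qed.

(** Existence suffices here: the gradients of the series are computed from their recursions. *)
Lemma has_gradient_Theta k r (eps : int) : (k <= 2 * n)%N ->
  exists G, has_gradient z0 (fun z => Theta (farg z) 1 k r eps) G.
Proof.
elim: k r => [|k IH] [|r] km.
- exists 0; under eq_fun do rewrite Theta0; exact: has_gradient_cst.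
- exists 0; under eq_fun do rewrite Theta_gt //; exact: has_gradient_cst.
- exists 0; under eq_fun do rewrite Theta0; exact: has_gradient_cst.
have [G1 h1] := IH r.+1 (ltnW km); have [G2 h2] := IH r (ltnW km).
have [G hf] : exists G, has_gradient z0 (fun z => farg z (Ordinal km)) G.
  by eexists; exact: has_log_gradient_farg _ z0_neq0 (Ordinal km).
have [G3 h3] : exists G, has_gradient z0
    (fun z => farg z (Ordinal km) ^ ((-1) ^ (r.+1%:Z + eps))) G.
  have [->|->] := sign_expz_or (r.+1%:Z + eps); first by exists G.
  by eexists; apply: has_gradientV hf; exact: farg_neq0.
eexists; under eq_fun do rewrite ThetaS.
apply: has_gradientD; first exact: h1.
by apply: has_gradientM; [exact: h2|exact: h3].
Qed.

Lemma has_gradient_theta_series odd eps x k : (k <= 2 * n)%N ->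
  has_gradient z0 (theta_series odd eps x k)
    (gradient (theta_series odd eps x k) z0).
Proof.
move=> km; suff [G hG] : exists G, has_gradient z0 (theta_series odd eps x k) G.
  by rewrite (has_gradientE _ _ _ hG).
pose dg (r : 'I_n.+1) := gradient
  (fun z => Theta (farg z) 1 k (2 * r + odd) eps) z0.
exists (\sum_(r < n.+1) x ^+ r *: dg r); apply: has_gradient_sum => r.
apply: has_gradientZ; have [G hG] := has_gradient_Theta k (2 * r + odd) eps km.
by rewrite /dg (has_gradientE _ _ _ hG).
Qed.

Lemma has_gradient_integral p q s r :
  has_gradient z0 (@integral_I R n p q s r)
    (gradient (@integral_I R n p q s r) z0).
Proof.
suff [G hG] : exists G, has_gradient z0 (@integral_I R n p q s r) G.
  by rewrite (has_gradientE _ _ _ hG).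
have hT k eps := has_gradient_Theta (2 * n) k eps (leqnn _).
have [G1 h1] := hT (2 * r - 1)%N 0; have [G2 h2] := hT (2 * r - 1)%N 1.
have [G3 h3] := hT (2 * r)%N 1; have [G4 h4] := hT (2 * r)%N 0.
have hZ := has_log_gradient_prod_coord z0 z0_neq0.
have Z0 : \prod_i z0 0 i != 0 by apply/prodf_neq0.
have hV := has_gradientV _ _ _ Z0 hZ.
eexists; apply: has_gradientD; last by apply: has_gradientZ; exact: h4.
apply: has_gradientD; last by apply: has_gradientZ; exact: h3.
apply: has_gradientZ; apply: has_gradientD.
  by apply: has_gradientM; [exact: hZ|exact: h1].
by apply: has_gradientM; [exact: hV|exact: h2].
Qed.

Lemma has_gradient_arg_sign k (e : int) : (k <= 2 * n)%N -> e = 1 \/ e = -1 ->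
  has_gradient z0 (fun z => arg k z ^ e)
    ((e%:~R * arg k z0 ^ e) *: arg_log_gradient k).
Proof.
move=> km; have hf := has_gradient_arg k km; have f0 := arg_neq0 k.
move=> [->|->]; first by rewrite mul1r; exact: hf.
apply: has_gradient_eq; first by apply: has_gradientV hf.
by rewrite mulrN1z exprN1; apply/rowP => l; rewrite !mxE; field.
Qed.

(** Differentiating the recursion gives the abstract hypothesis [AS] when [e = -1] and [DS] when
    [e = 1]. *)
Lemma gradient_theta_seriesS_even eps x k (e := (-1) ^ eps : int) :
    (k < 2 * n)%N ->
  gradient (theta_series 0 eps x k.+1) z0
  = gradient (theta_series 0 eps x k) z0 + (x * arg k z0 ^ e) *:
    (gradient (theta_series 1 eps x k) z0
     + (e%:~R * theta_series 1 eps x k z0) *: arg_log_gradient k).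
Proof.
move=> km; apply: has_gradientE.
rewrite (funext (fun z => theta_seriesS_even eps x k z km)).
have kw := ltnW km; have he : e = 1 \/ e = -1 by exact: sign_expz_or.
apply: has_gradient_eq.
  apply: (has_gradientD _ _ _ _ _ (has_gradient_theta_series 0 eps x k kw)).
  apply: has_gradientZ.
  apply: has_gradientM (has_gradient_arg_sign k e kw he) _.
  exact: has_gradient_theta_series.
by apply/rowP => l; rewrite !mxE -/e; ring.
Qed.

Lemma gradient_theta_seriesS_odd eps x k (e := - (-1) ^ eps : int) :
    (k < 2 * n)%N ->
  gradient (theta_series 1 eps x k.+1) z0
  = gradient (theta_series 1 eps x k) z0 + arg k z0 ^ e *:
    (gradient (theta_series 0 eps x k) z0
     + (e%:~R * theta_series 0 eps x k z0) *: arg_log_gradient k).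
Proof.
move=> km; apply: has_gradientE.
rewrite (funext (fun z => theta_seriesS_odd eps x k z km)).
have kw := ltnW km; have he : e = 1 \/ e = -1.
  by rewrite /e; have [->|->] := sign_expz_or eps; [right|left; rewrite opprK].
apply: has_gradient_eq.
  apply: (has_gradientD _ _ _ _ _ (has_gradient_theta_series 1 eps x k kw)).
  apply: has_gradientM (has_gradient_arg_sign k e kw he) _.
  exact: has_gradient_theta_series.
by apply/rowP => l; rewrite !mxE -/e; ring.
Qed.

Variables p q s : R.

Lemma gradient_integral_series x :
  gradient (integral_series p q s x) z0
  = (p * x) *: (arg (2 * n) z0 *: (gradient (theta_series 1 0 x (2 * n)) z0
      + theta_series 1 0 x (2 * n) z0 *: arg_log_gradient (2 * n))
    + (arg (2 * n) z0)^-1 *: (gradient (theta_series 1 1 x (2 * n)) z0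
      + - theta_series 1 1 x (2 * n) z0 *: arg_log_gradient (2 * n)))
    + q *: gradient (theta_series 0 1 x (2 * n)) z0
    + s *: gradient (theta_series 0 0 x (2 * n)) z0.
Proof.
have hT odd eps := has_gradient_theta_series odd eps x (2 * n) (leqnn _).
have hf := has_gradient_arg (2 * n) (leqnn _).
have f0 := arg_neq0 (2 * n); have hV := has_gradientV _ _ _ f0 hf.
apply: has_gradientE; apply: has_gradient_eq.
  apply: has_gradientD; last by apply: has_gradientZ; exact: hT.
  apply: has_gradientD; last by apply: has_gradientZ; exact: hT.
  apply: has_gradientZ; apply: has_gradientD.
    by apply: has_gradientM; [exact: hf|exact: hT].
  by apply: has_gradientM; [exact: hV|exact: hT].
move: (gradient (theta_series 1 0 x _) z0) (gradient (theta_series 1 1 x _) z0)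
  (gradient (theta_series 0 1 x _) z0) (gradient (theta_series 0 0 x _) z0)
  (theta_series 1 0 x _ z0) (theta_series 1 1 x _ z0) (arg_log_gradient _)
  (arg _ z0) f0 => C B A D c b F f f0.
by apply/rowP => l; rewrite !mxE; field.
Qed.

Lemma gradient_integral_seriesE x :
  gradient (integral_series p q s x) z0
  = \sum_(r < n) x ^+ r.+1 *: gradient (@integral_I R n p q s r.+1) z0.
Proof.
rewrite (funext (integral_seriesE p q s x)); apply: has_gradientE.
rewrite -[X in has_gradient _ _ X]add0r.
apply: has_gradientD; first exact: has_gradient_cst.
apply: (has_gradient_sum _ _ _
  (fun (r : 'I_n) z => x ^+ r.+1 * integral_I p q s r.+1 z)).
by move=> r; apply: has_gradientZ; exact: has_gradient_integral.
Qed.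

Lemma bracket_integral_series x y :
  bracket z0 (gradient (integral_series p q s x) z0)
    (gradient (integral_series p q s y) z0) = 0.
Proof.
rewrite !gradient_integral_series.
apply: (bracket_twisted_trace (bracket z0) _ _ _ _ (2 * n)
  (arg^~ z0) arg_log_gradient _ _
  (fun x k => theta_series 0 1 x k z0) (fun x k => theta_series 1 1 x k z0)
  (fun x k => theta_series 1 0 x k z0) (fun x k => theta_series 0 0 x k z0)
  (fun x k => gradient (theta_series 0 1 x k) z0)
  (fun x k => gradient (theta_series 1 1 x k) z0)
  (fun x k => gradient (theta_series 1 0 x k) z0)
  (fun x k => gradient (theta_series 0 0 x k) z0)).
all: try by move=> *; exact: theta_series0.
all: try by move=> *; rewrite (funext (theta_series0 _ _ _));
   apply: has_gradientE; exact: has_gradient_cst.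
- exact: bracketDl.
- exact: bracketZl.
- exact: bracketC.
- exact: bracketvv.
- by move=> k _; exact: arg_neq0.
- exact: bracket_arg.
- by move=> t k km; rewrite theta_seriesS_even // mulrA.
- by move=> t k km; rewrite theta_seriesS_odd.
- by move=> t k km; rewrite theta_seriesS_odd.
- by move=> t k km; rewrite theta_seriesS_even // mulrA.
- by move=> t k km; rewrite gradient_theta_seriesS_even // mulN1r.
- by move=> t k km; rewrite gradient_theta_seriesS_odd // mul1r.
- by move=> t k km; rewrite gradient_theta_seriesS_odd // mulN1r.
- by move=> t k km; rewrite gradient_theta_seriesS_even // mul1r.
Qed.

End Generating.

Theorem theorem8 (R : realType) (n : nat) (hn : (1 <= n)%N)
  (beta1 beta2 beta3 : R) (r s : nat)
  (hr : (1 <= r <= n)%N) (hs : (1 <= s <= n)%N)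
  (z : 'rV[R]_(2 * n)) (hz : forall i, z 0 i != 0) :
  poisson (integral_I beta1 beta2 beta3 r) (integral_I beta1 beta2 beta3 s) z
  = 0.
Proof.
pose G k := gradient (@integral_I R n beta1 beta2 beta3 k) z.
have bracket0 u : bracket z 0 u = 0.
  by rewrite -(scale0r 0) bracketZl mul0r.
have bracket_sum N (c : 'I_N -> R) (g : 'I_N -> 'rV[R]_(2 * n)) u :
    bracket z (\sum_i c i *: g i) u = \sum_i c i * bracket z (g i) u.
  rewrite (big_morph (bracket z ^~ u) (fun v w => bracketDl z v w u)
    (bracket0 u)).
  by apply: eq_bigr => i _; rewrite bracketZl.
case: r hr => [//|r] /= hr; case: s hs => [//|s] /= hs.
(* Coefficients are extracted one variable at a time: [x] is frozen and the identity is read as a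
   power sum in [y]. *)
have GH x : bracket z (G r.+1) (\sum_(k < n) x ^+ k.+1 *: G k.+1) = 0.
  apply: (power_sum_eq0 _ n (fun i => bracket z (G i.+1) _)) hr => y.
  rewrite -bracket_sum -!gradient_integral_seriesE //.
  exact: bracket_integral_series.
(* Antisymmetry moves the remaining index to the left, where the same extraction applies in [x]. *)
change (bracket z (G r.+1) (G s.+1) = 0); rewrite bracketC.
apply/eqP; rewrite oppr_eq0; apply/eqP.
apply: (power_sum_eq0 _ n (fun i => bracket z (G i.+1) _)) hs => x.
by rewrite -bracket_sum bracketC GH oppr0.
Qed.
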